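(* Let $k \geq 3$ be an integer, let $\mathbb{F}_{2^{k-1}}$ be the finite field with $2^{k-1}$ elements, and let $G = N \rtimes A$ be the Frobenius group of order $2^{k-1}(2^{k-1}-1)$, where the kernel $N$ is the additive group of $\mathbb{F}_{2^{k-1}}$ (an elementary abelian $2$-group of order $2^{k-1}$), the complement $A$ is the multiplicative group $\mathbb{F}_{2^{k-1}}^{\times}$ (cyclic of order $2^{k-1}-1$, generated by a primitive element), and $A$ acts on $N$ by field multiplication. Then $G$ possesses no $k$-fold factorization for the factorization $(2,\dots,2,2^{k-1}-1,2)$ of $|G|$; that is, there do not exist subsets $A_1,\dots,A_k \subseteq G$ with $|A_i| = 2$ for all $1 \leq i \leq k-2$, $|A_{k-1}| = 2^{k-1}-1$, and $|A_k| = 2$, such that $G = A_1 \cdots A_k$ is a factorization.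
   Context: For subsets $A_1,\dots,A_k$ of a group $G$, write $A_1\cdots A_k = \{x_1\cdots x_k : x_i\in A_i\}$. The product $G = A_1\cdots A_k$ is called a ($k$-fold) factorization of $G$ if the multiplication map $A_1\times\cdots\times A_k\to G$, $(x_1,\dots,x_k)\mapsto x_1\cdots x_k$, is bijective. When $G$ is finite, this is equivalent to $G = A_1\cdots A_k$ together with $|G| = |A_1|\cdots|A_k|$. *)

(* Defs.v *)
From HB Require Import structures.
From mathcomp Require Import all_boot all_order all_algebra all_fingroup all_solvable all_field.

Set Implicit Arguments.
Unset Strict Implicit.
Unset Printing Implicit Defensive.

Local Open Scope group_scope.

Section Factorization.
Variables (gT : finGroupType) (k : nat).

(* \prod over 'I_k is taken in increasing order of the index:
   x ord0 * ... * x ord_max. *)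
Definition mul_map (x : {ffun 'I_k -> gT}) : gT := \prod_(i < k) x i.

(* [family A] is the Cartesian product of the sets [A i]. *)
Definition factorization (G : {set gT}) (A : 'I_k -> {set gT}) : Prop :=
  {in family A &, injective mul_map} /\ mul_map @: family A = G.

End Factorization.

(* External semidirect product F ><| {unit F} of the additive group of F by its
   multiplicative group. MathComp actions are right actions, so conjugation
   n ^ a = a^-1 * n * a in this group is multiplication of n by a in F; since
   F is commutative, a |-> a^-1 identifies this with the left-action convention. *)
Definition field_frobenius (F : finFieldType) : finGroupType :=
  sdprod_groupType (FinRing.unit_groupAction F).

Definition frob_kernel (F : finFieldType) : {group field_frobenius F} :=
  [group of sdpair1 (FinRing.unit_groupAction F) @* [set: F]].

Definition frob_compl (F : finFieldType) : {group field_frobenius F} :=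
  [group of sdpair2 (FinRing.unit_groupAction F) @* [set: {unit F}]].

Lemma card_field_frobenius (F : finFieldType) :
  #|[set: field_frobenius F]| = (#|F| * #|F|.-1)%N.
Proof.
rewrite -(sdprod_card (sdprod_sdpair (FinRing.unit_groupAction F))).
rewrite !card_injm ?injm_sdpair1 ?injm_sdpair2 // cardsT.
by rewrite card_finField_unit.
Qed.

Lemma field_frobeniusP (F : finFieldType) : (2 < #|F|)%N ->
  [Frobenius [set: field_frobenius F] = frob_kernel F ><| frob_compl F].
Proof.
move=> F_gt2; set to := FinRing.unit_groupAction F.
have defG : frob_kernel F ><| frob_compl F = [set: field_frobenius F].
  exact: (sdprod_sdpair to).
have card1 : #|frob_kernel F| = #|F|.
  by rewrite card_injm ?injm_sdpair1 // cardsT.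
have card2 : #|frob_compl F| = #|F|.-1.
  by rewrite card_injm ?injm_sdpair2 // card_finField_unit.
apply/Frobenius_semiregularP => //.
- by rewrite -cardG_gt1 card1; apply: leq_trans F_gt2.
- by rewrite -cardG_gt1 card2 -ltnS prednK // (leq_trans _ F_gt2).
move=> x /setD1P[ntx /morphimP[a _ _ def_x]].
apply/trivgP/subsetP => y /setIP[/morphimP[n _ _ def_y] /cent1P cxy].
have : y ^ x = y by apply/conjg_fixP/commgP.
rewrite def_x def_y -sdpair_act // => /(injmP (injm_sdpair1 to)) /=.
rewrite !inE => /(_ isT isT) nE.
have : (n * (FinRing.uval a - 1) = 0)%R.
  by apply/eqP; rewrite GRing.mulrBr GRing.mulr1 GRing.subr_eq0 -FinRing.unit_actE nE.
move/eqP; rewrite GRing.mulf_eq0 GRing.subr_eq0 => /orP[/eqP n0 | a1].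
  by rewrite n0; apply/eqP; exact: (morph1 (sdpair1_morphism to)).
case/eqP: ntx; rewrite def_x (_ : a = 1); last by apply: val_inj; apply/eqP.
exact: (morph1 (sdpair2_morphism to)).
Qed.

(* Main.v *)
(** In a finite group [Y * [set s; t]] being a factorization says that right
    translation by [s * t^-1] swaps [Y] and its complement, so this element has
    even order.  In the Frobenius group at hand the complement has odd order, so
    an element of even order is a nontrivial element of the kernel, and any two
    of these are conjugate.  Hence, if [G = {u, v} X {s, t}], the elements
    [a = v^-1 u] and [c = s t^-1] are conjugate; as [u] and [v] differ by [a]
    and [s] and [t] by [c], the conjugating element can be taken to be some
    [x] in [X], and then [u x t = v x s] contradicts uniqueness. *)

Require Import Defs.
From mathcomp Require Import all_boot all_order all_algebra all_fingroup all_solvable all_field.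

Set Implicit Arguments.
Unset Strict Implicit.
Unset Printing Implicit Defensive.

Local Open Scope group_scope.

(** Collapsing all inner factors into the set [X] of their products leaves a three-fold
    factorization whose outer factors are unchanged. *)
Lemma factorization_ends (gT : finGroupType) (m : nat)
    (A : 'I_m.+2 -> {set gT}) :
  factorization [set: gT] A ->
  exists X : {set gT},
    (forall y x z y' x' z', y \in A ord0 -> x \in X -> z \in A ord_max ->
       y' \in A ord0 -> x' \in X -> z' \in A ord_max ->
       y * x * z = y' * x' * z' -> [/\ y = y', x = x' & z = z'])
    /\ (forall g, exists y x z,
         [/\ y \in A ord0, x \in X, z \in A ord_max & g = y * x * z]).
Proof.
move=> [injA imA].
pose mid (f : {ffun 'I_m.+2 -> gT}) :=
  \prod_(i < m) f (lift ord0 (widen_ord (leqnSn m) i)).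
have liftmax : lift ord0 (ord_max : 'I_m.+1) = ord_max by apply: val_inj.
have mulE f : mul_map f = f ord0 * mid f * f ord_max.
  by rewrite /mul_map big_ord_recl big_ord_recr /= liftmax mulgA.
exists (mid @: family A); split; last first.
  move=> g; have : g \in @mul_map gT _ @: family A by rewrite imA inE.
  case/imsetP=> f fA ->; exists (f ord0), (mid f), (f ord_max).
  by rewrite imset_f //; move/familyP: fA => fA; split.
move=> y x z y' x' z' yA /imsetP[f fA ->] zA y'A /imsetP[f' f'A ->] z'A eq_g.
(* Replacing the two end entries of a tuple preserves its inner product, so uniqueness for triples
   can be read off from injectivity on tuples. *)
pose upd (p : gT) (h : {ffun 'I_m.+2 -> gT}) (q : gT) :=
  [ffun i => if i == ord0 then p else if i == ord_max then q else h i].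
have updA p h q : p \in A ord0 -> h \in family A -> q \in A ord_max ->
    upd p h q \in family A.
  move=> pA /familyP hA qA; apply/familyP=> i; rewrite ffunE.
  by case: eqP => [->//|_]; case: eqP => [->//|_]; exact: hA.
have upd0 p h q : upd p h q ord0 = p by rewrite ffunE eqxx.
have updm p h q : upd p h q ord_max = q by rewrite ffunE eqxx.
have mid_upd p h q : mid (upd p h q) = mid h.
  apply: eq_bigr => i _; rewrite ffunE -liftmax (inj_eq lift_inj).
  by rewrite -!val_eqE /= (ltn_eqF (ltn_ord i)).
have /injA : mul_map (upd y f z) = mul_map (upd y' f' z').
  by rewrite !mulE !upd0 !updm !mid_upd.
move=> /(_ (updA _ _ _ yA fA zA) (updA _ _ _ y'A f'A z'A)) eq_f.
split; first by rewrite -(upd0 y f z) eq_f upd0.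
  by rewrite -(mid_upd y f z) eq_f mid_upd.
by rewrite -(updm y f z) eq_f updm.
Qed.

Lemma odd_expg_neq1 (gT : finGroupType) (Y : {set gT}) (s t : gT) (n : nat) :
  (forall g, exists2 y, y \in Y & g = y * s \/ g = y * t) ->
  (forall y y', y \in Y -> y' \in Y -> y * s <> y' * t) ->
  odd n -> (s * t^-1) ^+ n != 1.
Proof.
move=> covY disjY odd_n; set c := s * t^-1.
(* Everything rests on [g * s = (g * c) * t]: at most one of [g], [g * c] lies in [Y] by
   disjointness, at least one by covering [g * s]. *)
have swapY g : (g * c \in Y) = (g \notin Y).
  apply/idP/idP => [gcY | gY'].
    by apply/negP => gY; apply: (disjY g _ gY gcY); rewrite /c mulgA mulgKV.
  have [y yY [/mulIg gy | gy]] := covY (g * s); first by rewrite gy yY in gY'.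
  by rewrite /c mulgA gy mulgK.
have swapYn g : (g * c ^+ n \in Y) = ~~ (g \in Y).
  rewrite -[~~ _]/(true (+) (g \in Y)) -odd_n; elim: (n) => [|j IHj].
    by rewrite expg0 mulg1.
  by rewrite expgSr mulgA swapY IHj /= addNb.
apply/eqP => cn1; have := swapYn 1; rewrite cn1 mulg1.
by case: (1 \in Y).
Qed.

Lemma expg_index_normal (gT : finGroupType) (G N : {group gT}) (x : gT) :
  N <| G -> x \in G -> x ^+ #|G : N| \in N.
Proof.
move=> nsNG xG; have nNx := subsetP (normal_norm nsNG) x xG.
apply: coset_idr; first exact: groupX.
rewrite morphX // -card_quotient ?normal_norm //.
by rewrite expg_cardG // mem_quotient.
Qed.

(** The power [x ^+ #|H|] lies in [K], whose index is [#|H|]. It is nontrivial and commutes with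
    [x], and centralizers of nontrivial kernel elements lie in the kernel. *)
Lemma Frobenius_mem_ker (gT : finGroupType) (G K H : {group gT}) (x : gT) :
  [Frobenius G = K ><| H] -> x \in G -> x ^+ #|H| != 1 -> x \in K.
Proof.
move=> frobG xG xH1; have [defG _ _ _ _] := Frobenius_context frobG.
have [nsKG _ _ _ _] := sdprod_context defG.
have KxH : x ^+ #|H| \in K^#.
  by rewrite !inE xH1 (index_sdprod defG) ?expg_index_normal.
apply: (subsetP (Frobenius_cent1_ker frobG KxH)).
by rewrite inE xG; apply/cent1P/commuteX.
Qed.

Lemma frob_kernel_conj (F : finFieldType) (a c : field_frobenius F) :
  a \in frob_kernel F -> c \in frob_kernel F -> a != 1 -> c != 1 ->
  exists g, a ^ g = c.
Proof.
set to := FinRing.unit_groupAction F.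
move=> /morphimP[n _ _ ->] /morphimP[p _ _ ->] n1 p1.
have n0 : n != 0%R.
  by apply: contraNneq n1 => ->; rewrite (morph1 (sdpair1_morphism to)).
have p0 : p != 0%R.
  by apply: contraNneq p1 => ->; rewrite (morph1 (sdpair1_morphism to)).
have unp : (n^-1 * p)%R \is a GRing.unit.
  by rewrite GRing.unitfE GRing.mulf_neq0 ?GRing.invr_eq0.
(* Nonzero field elements form one orbit under multiplication: [n^-1 * p] carries [n] to [p]. *)
exists (sdpair2 to (FinRing.unit F unp)).
rewrite -sdpair_act ?inE //; congr (sdpair1 to _).
by rewrite /= FinRing.unit_actE /= GRing.mulrA GRing.divff ?GRing.mul1r.
Qed.

Lemma frobenius_no_factorization (F : finFieldType) (m : nat)
    (A : 'I_m.+2 -> {set field_frobenius F}) :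
  2 < #|F| -> odd #|F|.-1 -> #|A ord0| = 2 -> #|A ord_max| = 2 ->
  ~ factorization [set: field_frobenius F] A.
Proof.
move=> q_gt2 odd_q1 A0_2 Am_2 /factorization_ends[X].
have /eqP/cards2P[u [v [uv A0E]]] := A0_2.
have /eqP/cards2P[s [t [st AmE]]] := Am_2.
rewrite A0E AmE => -[uniqX covX].
have frobG := field_frobeniusP q_gt2.
have odd_compl : odd #|frob_compl F|.
  by rewrite card_injm ?injm_sdpair2 // card_finField_unit.
have memN x : (forall n, odd n -> x ^+ n != 1) -> x \in frob_kernel F /\ x != 1.
  move=> x_odd; split; last exact: (x_odd 1%N).
  by rewrite (Frobenius_mem_ker frobG) ?inE ?x_odd.
have [uA vA] : u \in [set u; v] /\ v \in [set u; v] by rewrite !inE !eqxx orbT.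
have [sA tA] : s \in [set s; t] /\ t \in [set s; t] by rewrite !inE !eqxx orbT.
have [cN c1] : s * t^-1 \in frob_kernel F /\ s * t^-1 != 1.
  apply: memN => n; apply: (@odd_expg_neq1 _ ([set u; v] * X)).
    move=> g; have [y [x [z [yA xX /set2P zA ->]]]] := covX g.
    exists (y * x); first exact: mem_mulg.
    by case: zA => ->; [left | right].
  move=> _ _ /mulsgP[y x yA xX ->] /mulsgP[y' x' y'A x'X ->].
  case/(uniqX _ _ _ _ _ _ yA xX sA y'A x'X tA) => _ _.
  exact/eqP.
have [aN a1] : v^-1 * u \in frob_kernel F /\ v^-1 * u != 1.
  rewrite -[u in v^-1 * u]invgK.
  (* Inversion turns the left factor [[set u; v]] into a right factor with elements [v^-1] and
     [u^-1], whose quotient is [v^-1 * u]. *)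
  apply: memN => n; apply: (@odd_expg_neq1 _ (X * [set s; t])^-1).
    move=> g; have [y [x [z [/set2P yA xX zA eq_g]]]] := covX g^-1.
    exists (x * z)^-1; first by rewrite mem_invg invgK mem_mulg.
    rewrite -!invMg !mulgA -(invgK g) eq_g.
    by case: yA => ->; [right | left].
  move=> y y'; rewrite !mem_invg => /mulsgP[x z xX zA /(canRL invgK) ->].
  move=> /mulsgP[x' z' x'X z'A /(canRL invgK) ->].
  rewrite -!invMg => /invg_inj; rewrite !mulgA => /esym.
  by case/(uniqX _ _ _ _ _ _ uA x'X z'A vA xX zA) => /eqP; rewrite (negPf uv).
have [g ag] := frob_kernel_conj aN cN a1 c1.
(* Factoring [u * g * t] replaces [g] by an element of [X]: [y^-1 * u] is trivial or [v^-1 * u], and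
   [t * z^-1] is trivial or the inverse of [s * t^-1], so neither correction affects the
   conjugation. *)
have [y [x [z [/set2P yA xX /set2P zA eq_g]]]] := covX (u * g * t).
have ax : (v^-1 * u) ^ x = s * t^-1.
  have -> : x = y^-1 * u * g * (t * z^-1).
    by rewrite !mulgA -2!(mulgA y^-1) eq_g -!mulgA mulKg mulgV mulg1.
  rewrite conjgM (conjgM _ _ g).
  have -> : (v^-1 * u) ^ (y^-1 * u) = v^-1 * u.
    by case: yA => ->; [rewrite mulVg conjg1 | rewrite conjgE mulKg].
  rewrite ag; case: zA => ->; last by rewrite mulgV conjg1.
  have <- : (s * t^-1)^-1 = t * s^-1 by rewrite invMg invgK.
  by rewrite conjgE invgK mulgV mulg1.
have /(uniqX _ _ _ _ _ _ uA xX tA vA xX sA)[/eqP] : u * x * t = v * x * s.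
  rewrite -(mulgKV t s) -ax conjgE !mulgA mulgK.
  by rewrite mulgV mul1g.
by rewrite (negPf uv).
Qed.

Local Close Scope group_scope.

Theorem theorem2p3 (k : nat) (hk : 3 <= k) (F : finFieldType)
    (hF : #|F| = 2 ^ (k - 1)) :
  ~ exists A : 'I_k -> {set field_frobenius F},
      [/\ forall i : 'I_k, i.+1 <= k - 2 -> #|A i| = 2,
          forall i : 'I_k, i.+1 = k - 1 -> #|A i| = 2 ^ (k - 1) - 1,
          forall i : 'I_k, i.+1 = k -> #|A i| = 2
        & factorization [set: field_frobenius F] A].
Proof.
case: k hk hF => [|[|[|m]]] // _ hF [A [A2 _ Am2]].
apply: frobenius_no_factorization.
- by rewrite hF subn1 /= (leq_trans (_ : 2 < 2 ^ 2)) // leq_exp2l.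
- by rewrite hF subn1 /= -subn1 oddB ?expn_gt0 // oddX.
(* As [k] is at least 3, the first index is among the first [k - 2]. *)
- by apply: A2; rewrite !subSS subn0.
- exact: Am2.
Qed.
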